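(* Let $T$ be a locally finite rooted tree with edge set $E$ and let $\mu$ be a positive Borel measure on $\overline{T}$. For $s\ge1$ put $$[[\mu]]_s:=\sup_{\alpha\in E}\frac{1}{\mu(S(\alpha))}\int_{S(\alpha)}\Big(\int_{S(\alpha)}d(x\wedge y)\,d\mu(x)\Big)^s d\mu(y).$$ The following are equivalent. (a) The Hardy inequality holds: there is a finite constant $[\mu]$ such that $$\int_{\overline{T}}\Big(\sum_{\alpha\in[o^*,x]}\varphi(\alpha)\Big)^2d\mu(x)\le[\mu]\sum_{\alpha\in E}\varphi(\alpha)^2\qquad\text{for all }\varphi:E\to[0,\infty).$$ (b) $[[\mu]]_s<\infty$ for some $s\ge1$. (c) $[[\mu]]_s<\infty$ for every $s\ge1$.
   Context: Tree setting. $T$ is a simple connected graph without cycles, with finite or countable vertex set, in which every vertex has finitely many neighbours; $E$ is its set of edges. A root vertex $o$ is fixed, together with an auxiliary pre-root vertex $o^*$ which is joined to $o$ (by the root edge $\omega\in E$) and to no other vertex. $T$ also denotes the set of vertices other than $o^*$. For vertices $x,y$, $[x,y]$ is the set of edges of the unique geodesic joining them. $\partial T$ is the set of maximal geodesics starting at $o^*$; if $T$ is infinite all of these are assumed infinite, and if $T$ is finite a maximal geodesic is identified with the leaf at which it ends. For $x\in\partial T$, $[o^*,x]$ is the set of edges of the geodesic $x$. Put $\overline{T}=T\cup\partial T$ and, for $\alpha\in E$, $S(\alpha)=\{x\in\overline{T}:\alpha\in[o^*,x]\}$. $\overline{T}$ carries the (compact) topology generated by the sets $S(\alpha)$, $\alpha\in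 E$, and the singletons $\{x\}$, $x\in T$; positive Borel measures on $\overline{T}$ are finite. For $x,y\in\overline{T}$ the confluent $x\wedge y\in\overline{T}$ is defined by $[o^*,x\wedge y]=[o^*,x]\cap[o^*,y]$, and $d(x\wedge y)\in\mathbb{N}\cup\{\infty\}$ is the number of edges in $[o^*,x\wedge y]$ (so it is $+\infty$ if $x=y$ is an infinite boundary geodesic). Conventions: $0\cdot\infty=0$ in integrals, and a quotient is $0$ when $\mu(S(\alpha))=0$. *)

(* Defs.v *)
From HB Require Import structures.
From mathcomp Require Export all_boot all_order all_algebra finmap.
From mathcomp Require Export all_classical all_reals all_analysis.

Set Implicit Arguments.
Unset Strict Implicit.
Unset Printing Implicit Defensive.

Import Order.TTheory GRing.Theory Num.Theory.

Local Open Scope classical_set_scope.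
Local Open Scope ring_scope.

Section Graph.
Variables (V : countType) (adj : rel V).

Definition graph_connected :=
  forall x y : V, exists p : seq V, path adj x p /\ last x p = y.

Definition graph_acyclic :=
  forall c : seq V, uniq c -> (2 < size c)%N -> ~~ cycle adj c.

(* [x :: p] is a path of minimal length between its end points. *)
Definition geodesic (x : V) (p : seq V) :=
  path adj x p /\
  forall q : seq V, path adj x q -> last x q = last x p -> (size p <= size q)%N.

Definition geodesic_ray (g : nat -> V) :=
  forall n, geodesic (g 0%N) (mkseq (fun i => g i.+1) n).

(* An (unoriented) edge is the set of its two end points. *)
Definition graph_edges : set {fset V} :=
  [set a | exists x y : V, adj x y /\ a = [fset x; y]%fset].

Definition path_edges (x : V) (p : seq V) : seq {fset V} :=
  pairmap (fun u v => [fset u; v]%fset) x p.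

(* In a tree exactly one geodesic joins x to y, so this is [x, y]. *)
Definition segment (x y : V) : set {fset V} :=
  [set a | exists p, [/\ geodesic x p, last x p = y & a \in path_edges x p]].

Definition ray_edges (g : nat -> V) : set {fset V} :=
  [set [fset g n; g n.+1]%fset | n in [set: nat]].

End Graph.

(* The vertex type contains the pre-root.  By [tree_no_leaf], a maximal geodesic
   starting at the pre-root is infinite as soon as the tree is. *)
Record rootedTree := RootedTree {
  vertex :> countType;
  adj : rel vertex;
  root : vertex;
  preroot : vertex;
  adj_sym : symmetric adj;
  adj_irr : irreflexive adj;
  tree_connected : graph_connected adj;
  tree_acyclic : graph_acyclic adj;
  tree_locally_finite : forall x, finite_set [set y | adj x y];
  preroot_adj : forall x, adj preroot x = (x == root);
  tree_no_leaf : infinite_set [set: vertex] ->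
    forall p, geodesic adj preroot p -> exists v, geodesic adj preroot (rcons p v)
}.

Definition edges (T : rootedTree) : set {fset T} := graph_edges (@adj T).

(* The vertices other than the pre-root, together with the boundary.  If T is
   finite there are no rays: the boundary points are then the leaves, which
   already occur as vertices. *)
Inductive Tbar (T : rootedTree) : Type :=
| Inner (x : T) of x != preroot T
| Bdry (g : nat -> T) of g 0%N = preroot T & geodesic_ray (@adj T) g.

Lemma root_neq_preroot (T : rootedTree) : root T != preroot T.
Proof.
apply/eqP => e.
by have := preroot_adj (preroot T); rewrite adj_irr e eqxx.
Qed.

(* The edge set [o*, x]. *)
Definition stem (T : rootedTree) (x : Tbar T) : set {fset T} :=
  match x with
  | Inner v _ => segment (@adj T) (preroot T) v
  | Bdry g _ _ => ray_edges g
  end.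

Definition shadow (T : rootedTree) (a : {fset T}) : set (Tbar T) :=
  [set x | stem x a].

(* The topology is the coarsest one in which the shadows S(a) of the edges and
   the singletons of vertices are open. *)
Definition Tbar_subbase (T : rootedTree) : set (set (Tbar T)) :=
  [set shadow a | a in @edges T] `|`
  [set A | exists (x : T) (hx : x != preroot T), A = [set Inner hx]].

HB.instance Definition _ (T : rootedTree) := gen_eqMixin (Tbar T).
HB.instance Definition _ (T : rootedTree) := gen_choiceMixin (Tbar T).
HB.instance Definition _ (T : rootedTree) :=
  isPointed.Build (Tbar T) (Inner (root_neq_preroot T)).
HB.instance Definition _ (T : rootedTree) :=
  isSubBaseTopological.Build (Tbar T) (@Tbar_subbase T) id.

Notation borelTbar T := (g_sigma_algebraType (@open (Tbar T))).

(* x and y lie in S(root edge), so exactly one point z qualifies. *)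
Definition confluent (T : rootedTree) (x y : Tbar T) : Tbar T :=
  [get z | stem z = stem x `&` stem y].

Definition depth (R : realType) (T : rootedTree) (x : Tbar T) : \bar R :=
  counting (stem x).

Section Energy.
Local Open Scope ereal_scope.

(* [[mu]]_s; in \bar R, 0 * +oo = 0, and +oo `^ s = +oo for s > 0. *)
Definition energy (R : realType) (T : rootedTree)
    (mu : {finite_measure set (borelTbar T) -> \bar R}) (s : R) : \bar R :=
  ereal_sup
    [set (if mu (shadow a) == 0 then 0 else
           (mu (shadow a))^-1 *
           \int[mu]_(y in shadow a)
             ((\int[mu]_(x in shadow a) depth R (confluent x y)) `^ s))
    | a in @edges T].

End Energy.

(* Main.v *)
Require Import Defs.
From mathcomp Require Import ring lra zify.
From mathcomp Require Import measurable_realfun measurable_fun_approximation.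
Set Implicit Arguments.
Unset Strict Implicit.
Unset Printing Implicit Defensive.
Import Order.TTheory GRing.Theory Num.Theory.
Local Open Scope classical_set_scope.
Local Open Scope ring_scope.
Local Open Scope ereal_scope.

(** The distance d(x /\ y) is the number of edges a such that both x and y lie
    in the shadow S(a), so the tree enters only through its family of shadows,
    and this family is laminar: two shadows are nested or disjoint.  The theorem
    holds for every sequence of measurable sets S i which is laminar, with
    M i = mu (S i).  The pivot is the Carleson condition (predicate [carleson])

      sum_j mu (S i & S j) ^ 2 <= K * M i   for all i,

    whose left-hand side is the integral over S i of the function
    F i y = sum_(j | y in S j) mu (S i & S j), that is, of the inner integral of
    the energy.  So it says that the energy is finite for s = 1.

    - It follows from finite energy for some s >= 1, because t <= 1 + t ^ s
      ([energy_carleson]).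

    - It follows from the Hardy inequality by testing on the weights
      phi j = mu (S i & S j), truncated to finitely many j: the sum Q of their
      squares is the integral of their potential over S i, and Cauchy-Schwarz
      gives Q <= C * M i ([hardy_carleson]).

    - It implies the Hardy inequality ([carleson_hardy]).  The sets of the family
      which contain a given point form a chain, and along a chain the square of a
      sum is at most twice the sum over ordered pairs.  With h j the sum of the
      weights of the sets containing S j, this bounds the left-hand side by 2 Z,
      where Z = sum_j phi j * h j * M j.  Applied to h itself, and combined with
      the Carleson condition, it also bounds sum_j (M j * h j) ^ 2 by 2 K Z.  As
      Z is a scalar product of phi with M h, these two facts give
      Z <= 2 K * sum_j phi j ^ 2 ([dual_energy_le]).

    - It implies finite energy for every s ([carleson_energy]).  On S i the
      function F i is at most K + G i, where G i y is the sum of the M j over the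
      S j which contain y and are included in S i ([confluent_mass_le_chain]).
      Along a chain, (sum a) ^ (n+1) <= (n+1) * sum_j a_j * (tail sum at j) ^ n,
      a discrete form of the derivative of a power ([chain_expr_le]).
      Integrated, this bounds the moment of order n+1 of G i over S i by
      (n+1) * sum_(S j included in S i) M j * (moment of order n of G j over S j),
      hence by (n+1) * K times the constant of order n, by the Carleson condition
      ([mass_below_moment]).  Arbitrary exponents follow from integer ones.

    On the side of the tree, acyclicity is used through one fact: a vertex has a
    unique neighbour closer to the pre-root ([no_upper_path],
    [lower_nbr_unique]).  Then an edge of a geodesic determines all the edges
    before it, which makes shadows laminar ([shadow_laminar]), and the common
    part of two geodesics is again the stem of a point, so that confluents exist
    ([stem_confluent]). *)

(** * Power sums along chains *)

Lemma exprD_le (R : realDomainType) (x y : R) n : (0 <= x)%R -> (0 <= y)%R ->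
  ((x + y) ^+ n.+1 <= n.+1%:R * (x * (x + y) ^+ n) + y ^+ n.+1)%R.
Proof.
move=> x0 y0; rewrite -lerBlDr subrXX addrK mulrCA ler_wpM2l //.
rewrite mulr_natl -[in leRHS](card_ord n.+1) -sumr_const; apply: ler_sum => i _.
rewrite -[in leRHS](subnK (leq_ord i)) exprD ler_wpM2l ?exprn_ge0 ?addr_ge0 //.
by rewrite lerXn2r ?nnegrE ?addr_ge0 // lerDr.
Qed.

(** Adding the terms from the bottom of the chain to its top, each new term x
    raises the power of the sum s by at most (n+1) * x * (x + s) ^ n.  The
    relation is only a preorder: equivalent indices see each other's terms,
    which makes the right-hand side larger. *)
Lemma chain_expr_le (R : realDomainType) (I : eqType) (le : rel I)
    (r : seq I) (P : pred I) (a : I -> R) n :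
  (forall i, 0 <= a i)%R -> transitive le -> {in P &, total le} ->
  ((\sum_(i <- r | P i) a i) ^+ n.+1 <=
   n.+1%:R * \sum_(i <- r | P i)
     a i * (\sum_(j <- r | P j && le j i) a j) ^+ n)%R.
Proof.
move=> a0 le_tr; set le' := fun i j => le j i => le_tot.
(* The induction peels off a largest index, so the list is sorted downwards. *)
set s := sort le' [seq i <- r | P i].
have ps : perm_eq [seq i <- r | P i] s by rewrite perm_sym perm_sort.
rewrite -big_filter -[X in (_ <= _ * X)%R]big_filter.
rewrite (perm_big _ ps) [X in (_ <= _ * X)%R](perm_big _ ps) /=.
under [X in (_ <= _ * X)%R]eq_bigr do
  rewrite -big_filter_cond (perm_big _ ps) /=.
have allP : all P [seq i <- r | P i].
  by apply/allP => i; rewrite mem_filter => /andP[].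
have le'_tot : {in P &, total le'} by move=> i j Pi Pj; exact: le_tot.
have le'_tr : transitive le' by move=> i j k ji ik; exact: le_tr ik ji.
have := sort_sorted_in le'_tot allP; rewrite -/s.
rewrite (sorted_pairwise le'_tr).
have Ps : all P s by rewrite all_sort.
elim: s {ps allP} Ps => [|i t IH] /=; first by rewrite !big_nil expr0n mulr0.
move=> /andP[Pi Pt] /andP[lei /(IH Pt){}IH].
have lsum (Q : pred I) u : (0 <= \sum_(j <- u | Q j) a j)%R.
  by apply: sumr_ge0 => j _; exact: a0.
rewrite !big_cons mulrDr.
have := exprD_le n (a0 i) (lsum xpredT t) => /le_trans; apply.
have lii : le i i by have := le_tot i i Pi Pi; rewrite orbb.
apply: lerD; last first.
  apply: (le_trans IH); rewrite ler_wpM2l // ler_sum // => j _.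
  rewrite ler_wpM2l // lerXn2r ?nnegrE // big_cons; case: ifP => // _.
  by rewrite lerDr.
rewrite lii ler_wpM2l // ler_wpM2l // lerXn2r ?nnegrE ?addr_ge0 //.
rewrite lerD2l [leRHS]big_mkcond [leLHS]big_seq [leRHS]big_seq.
by apply: ler_sum => j jt; move/allP: lei => /(_ j jt); rewrite /le' => ->.
Qed.

(** * Powers and integrals of nonnegative series *)
Lemma emeasurable_fun_expe d (X : measurableType d) (R : realType) (D : set X)
    (f : X -> \bar R) n :
  measurable_fun D f -> measurable_fun D (fun x => f x ^+ n).
Proof.
move=> mf; elim: n => [|n IH].
  by under eq_fun do rewrite expe0; exact: measurable_cst.
by under eq_fun do rewrite expeS; exact: emeasurable_funM.
Qed.

Lemma poweR_ge_sub1 (R : realType) (x : \bar R) s :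
  0 <= x -> (1 <= s)%R -> x <= 1 + x `^ s.
Proof.
case: x => [r||//]; last first.
  move=> _ s1; have s0 : (0 < s)%R := lt_le_trans ltr01 s1.
  by rewrite poweRyr ?addey // gt_eqF.
rewrite lee_fin poweR_EFin -EFinD lee_fin => r0 s1.
have [r1|r1] := leP r 1%R; first by rewrite (le_trans r1) // lerDl powR_ge0.
apply: (@le_trans _ _ (r `^ s)%R); last by rewrite lerDr.
by rewrite -[leLHS]powRr1 // ler_powR // ltW.
Qed.

Lemma poweR_le_expe (R : realType) (x : \bar R) s n :
  0 <= x -> (0 < s)%R -> (s <= n%:R)%R -> x `^ s <= 1 + x ^+ n.
Proof.
move=> + s0 sn; have n0 : (0 < n)%N by rewrite -(ltr0n R) (lt_le_trans s0).
case: x => [r||//]; last first.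
  move=> _; suff -> : (+oo : \bar R) ^+ n = +oo by rewrite leey.
  case: n n0 {sn} => // n _.
  by elim: n => [|n IH]; rewrite ?expe1 // expeS IH mulyy.
rewrite lee_fin poweR_EFin -EFin_expe -EFinD lee_fin => r0.
have [r1|r1] := leP r 1%R.
  have : (r `^ s <= 1 `^ s)%R by rewrite ge0_ler_powR ?nnegrE // ltW.
  by rewrite powR1 => /le_trans; apply; rewrite lerDl exprn_ge0.
apply: (@le_trans _ _ (r ^+ n)%R); last by rewrite lerDr.
by rewrite -powR_mulrn // ler_powR // ltW.
Qed.

Section PowerSeriesIntegral.
Context d (X : measurableType d) (R : realType).
Variable mu : {measure set X -> \bar R}.

Lemma cvge_expr (u : nat -> R) (l : \bar R) k : (0 < k)%N ->
  (fun N => (u N)%:E) @ \oo --> l -> 0 <= l ->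
  (fun N => ((u N) ^+ k)%:E) @ \oo --> l ^+ k.
Proof.
move=> k0; case: l => [l|+ _|//].
  move=> /fine_cvg ul _; rewrite -EFin_expe; apply: cvg_EFin.
    by apply: nearW => N.
  have := @cvg_comp _ _ _ u (fun x => x ^+ k)%R _ _ _ ul.
  by apply; exact: exprn_continuous.
case: k k0 => // k _ /cvgeyPge uy.
have -> : (+oo : \bar R) ^+ k.+1 = +oo.
  by elim: k => [|k IH]; rewrite ?expe1 // expeS IH mulyy.
apply/cvgeyPge => A; have := uy (Num.max A 1%R); apply: filterS => N.
rewrite !lee_fin ge_max => /andP[Au u1]; apply: (le_trans Au).
by rewrite exprS ler_peMr ?(le_trans ler01) // exprn_ege1.
Qed.

(** Monotone convergence reduces bounds on powers of series to bounds on powers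
    of finite real sums, for which the algebra of chains is available. *)
Lemma integral_series_expr_le (D : set X) (u : nat -> X -> R) k c :
  measurable D -> (0 < k)%N ->
  (forall j, measurable_fun D (u j)) -> (forall j x, 0 <= u j x)%R ->
  (forall N, \int[mu]_(x in D) ((\sum_(0 <= j < N) u j x) ^+ k)%:E <= c) ->
  \int[mu]_(x in D) (\sum_(j <oo) (u j x)%:E) ^+ k <= c.
Proof.
move=> mD k0 mu_ u0 uc.
have s0 N x : (0 <= \sum_(0 <= j < N) u j x)%R by apply: sumr_ge0.
pose g (N : nat) x : \bar R := ((\sum_(0 <= j < N) u j x) ^+ k)%:E.
have mg N : measurable_fun D (g N).
  by apply/measurable_EFinP; apply: measurable_funX; exact: measurable_sum.
have g0 N x : D x -> 0 <= g N x by rewrite lee_fin exprn_ge0.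
have g_nd x : D x -> {homo g ^~ x : M N / (M <= N)%N >-> M <= N}.
  move=> _ M N MN; rewrite lee_fin lerXn2r ?nnegrE //.
  by rewrite [leRHS](big_cat_nat _ MN) //= lerDl sumr_ge0.
have cvg_g x : g ^~ x @ \oo --> (\sum_(j <oo) (u j x)%:E) ^+ k.
  apply: cvge_expr => //; last by apply: nneseries_ge0 => j _ _; rewrite lee_fin.
  under eq_fun do rewrite -sumEFin.
  by apply: is_cvg_nneseries => j _ _; rewrite lee_fin.
have -> : \int[mu]_(x in D) (\sum_(j <oo) (u j x)%:E) ^+ k =
    \int[mu]_(x in D) limn (g ^~ x).
  by apply: eq_integral => x _; apply/esym/cvg_lim.
rewrite monotone_convergence //.
apply: lime_le; last by apply: nearW => N; exact: uc.
apply: ereal_nondecreasing_is_cvgn => M N MN; apply: ge0_le_integral => //.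
- exact: g0.
- by move=> x Dx; apply: (g_nd x Dx).
Qed.

End PowerSeriesIntegral.

(** * Laminar sequences and the Carleson condition *)
Section Laminar.
Context d (X : measurableType d) (R : realType).
Variable mu : {finite_measure set X -> \bar R}.
Variable S : nat -> set X.
Hypothesis mS : forall i, measurable (S i).
Hypothesis lamS : forall i j,
  [\/ S i `&` S j = set0, S i `<=` S j | S j `<=` S i].
Implicit Types (i j k n N : nat) (x y : X) (K : R).

Definition overlap i j : R := fine (mu (S i `&` S j)).
Definition mass i : R := overlap i i.
Definition sub_idx i j : bool := `[< S i `<=` S j >].

Definition carleson K := forall i N,
  (\sum_(0 <= j < N) overlap i j ^+ 2 <= K * mass i)%R.

Lemma overlapE i j : mu (S i `&` S j) = (overlap i j)%:E.
Proof. by rewrite /overlap fineK // fin_num_measure //; exact: measurableI. Qed.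

Lemma massE i : mu (S i) = (mass i)%:E.
Proof. by rewrite /mass -overlapE setIid. Qed.

Lemma overlap_ge0 i j : (0 <= overlap i j)%R.
Proof. exact: fine_ge0. Qed.

Lemma mass_ge0 i : (0 <= mass i)%R.
Proof. exact: overlap_ge0. Qed.
#[local] Hint Resolve overlap_ge0 mass_ge0 : core.

Lemma overlap_subl i j : sub_idx i j -> overlap i j = mass i.
Proof. by move=> /asboolP sij; rewrite /mass /overlap setIid setIidl. Qed.

Lemma overlap_subr i j : sub_idx j i -> overlap i j = mass j.
Proof. by move=> /asboolP sji; rewrite /mass /overlap setIid setIidr. Qed.

Lemma sub_idx_trans : transitive sub_idx.
Proof.
by move=> j i k /asboolP ij /asboolP jk; apply/asboolP; exact: subset_trans jk.
Qed.

Lemma sub_idx_total x i j : S i x -> S j x -> sub_idx i j || sub_idx j i.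
Proof.
move=> Six Sjx; case: (lamS i j) => [e|ij|ji].
- by have : (S i `&` S j) x by []; rewrite e.
- by apply/orP; left; apply/asboolP.
- by apply/orP; right; apply/asboolP.
Qed.

Lemma mass_gt0_nonempty i : (0 < mass i)%R -> exists x, S i x.
Proof.
move=> mi; have [e|/set0P//] := eqVneq (S i) set0.
by move: mi; rewrite -lte_fin -massE e measure0 ltxx.
Qed.

Local Notation ind i x := (\1_(S i) x : R).

Lemma integral_mass i (c : R) : \int[mu]_(x in S i) c%:E = (c * mass i)%:E.
Proof. by rewrite (integral_cst mu (mS i)) EFinM -massE. Qed.

Lemma sum_indic (P : pred nat) (c : nat -> R) N x :
  (\sum_(0 <= j < N | P j) c j * ind j x =
   \sum_(0 <= j < N | P j && `[< S j x >]) c j)%R.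
Proof.
rewrite [RHS]big_mkcondr; apply: eq_bigr => j _; rewrite indicE.
rewrite (_ : (x \in S j) = `[< S j x >]); last by apply/idP/asboolP; rewrite inE.
by case: ifP; rewrite ?mulr1 ?mulr0.
Qed.

Lemma integral_sum_indic (D : set X) (P : pred nat) (c : nat -> R)
    (f : nat -> X -> R) N :
  measurable D -> (forall j, 0 <= c j)%R -> (forall j x, 0 <= f j x)%R ->
  (forall j, measurable_fun setT (f j)) ->
  \int[mu]_(x in D) (\sum_(0 <= j < N | P j) c j * (f j x * ind j x))%:E =
  \sum_(0 <= j < N | P j) (c j)%:E * \int[mu]_(x in D `&` S j) (f j x)%:E.
Proof.
move=> mD c0 f0 mf.
have mfi j : measurable_fun D (fun x => (f j x * ind j x)%:E).
  apply/measurable_EFinP; apply: measurable_funTS.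
  by apply: measurable_funM.
have fi0 j x : D x -> 0 <= (f j x * ind j x)%:E by rewrite lee_fin mulr_ge0.
under eq_integral do rewrite -sumEFin big_mkcond /=.
rewrite ge0_integral_sum //; last 2 first.
- move=> j; case: (P j) => //; under eq_fun do rewrite EFinM.
  exact: measurable_funeM.
- by move=> j x Dx; case: (P j) => //; rewrite EFinM mule_ge0 ?lee_fin //; exact: fi0 Dx.
rewrite [RHS]big_mkcond /=; apply: eq_bigr => j _; case: (P j); last first.
  exact: integral0.
under eq_integral do rewrite EFinM; rewrite ge0_integralZl ?lee_fin //; last exact: fi0.
congr (_ * _); rewrite integral_mkcondr; apply: eq_integral => x _.
by rewrite patchE indicE; case: ifP; rewrite ?mulr1 ?mulr0.
Qed.

(** For y in S i this is the integral over x in S i of the number of members of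
    the family which contain both x and y, the two sums being exchanged. *)
Definition confluent_mass i x : \bar R :=
  \sum_(j <oo) (overlap i j * ind j x)%:E.

Lemma measurable_confluent_mass i D :
  measurable D -> measurable_fun D (confluent_mass i).
Proof.
move=> mD; apply: (ge0_emeasurable_sum (P := xpredT)) => [j x _ _|j _].
  by rewrite lee_fin mulr_ge0.
by apply/measurable_EFinP; apply: measurable_funM.
Qed.

Lemma confluent_mass_ge0 i x : 0 <= confluent_mass i x.
Proof. by apply: nneseries_ge0 => j _ _; rewrite lee_fin mulr_ge0. Qed.

Lemma integral_confluent_mass i : \int[mu]_(x in S i) confluent_mass i x =
  \sum_(j <oo) (overlap i j ^+ 2)%:E.
Proof.
rewrite integral_nneseries //.
- apply: eq_eseriesr => j _; under eq_integral do rewrite EFinM.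
  rewrite ge0_integralZl ?lee_fin //; last first.
    by apply/measurable_EFinP; exact: measurable_indic.
  rewrite integral_indic // setIC expr2 EFinM; congr (_ * _); exact: overlapE.
- by move=> j; apply/measurable_EFinP; apply: measurable_funM.
- by move=> j x _; rewrite lee_fin mulr_ge0.
Qed.

Section Carleson.
Variable K : R.
Hypotheses (K0 : (0 < K)%R) (carl : carleson K).

Lemma sum_below i N :
  (\sum_(0 <= j < N | sub_idx j i) mass j ^+ 2 <= K * mass i)%R.
Proof.
apply: le_trans (carl i N); rewrite big_mkcond /=; apply: ler_sum => j _.
by case: ifP => [/overlap_subr ->//|_]; rewrite exprn_ge0.
Qed.

(** If S i is included in S j then the overlap is M i, so p such indices j
    contribute p * (M i) ^ 2 <= K * M i to the Carleson sum. *)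
Lemma sum_above i N : (0 < mass i)%R ->
  (\sum_(0 <= j < N | sub_idx i j) mass i <= K)%R.
Proof.
move=> mi; rewrite -(ler_pM2r mi) mulr_suml.
apply: le_trans (carl i N); rewrite big_mkcond /=; apply: ler_sum => j _.
by case: ifP => [/overlap_subl ->//|_]; rewrite ?exprn_ge0 // expr2.
Qed.

Definition weight_above (phi : nat -> R) N i : R :=
  (\sum_(0 <= j < N | sub_idx i j) phi j)%R.

Lemma weight_above_ge0 phi N i :
  (forall j, 0 <= phi j)%R -> (0 <= weight_above phi N i)%R.
Proof. by move=> p0; exact: sumr_ge0. Qed.

(** The sets which contain S i form a chain as soon as S i is not empty. *)
Lemma weight_above_sqr_le phi N i :
  (forall j, 0 <= phi j)%R -> (0 < mass i)%R ->
  (weight_above phi N i ^+ 2 <=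
   2 * \sum_(0 <= j < N | sub_idx i j) phi j * weight_above phi N j)%R.
Proof.
move=> p0 /mass_gt0_nonempty[x Six].
have := @chain_expr_le _ _ (fun j k => sub_idx k j) (index_iota 0 N)
  (sub_idx i) phi 1 p0.
move=> /(_ _ _)/le_trans; apply.
- by move=> j k l jk kl; exact: sub_idx_trans kl jk.
- move=> j k /asboolP ij /asboolP ik.
  by rewrite orbC; apply: (@sub_idx_total x); [exact: ij|exact: ik].
rewrite ler_wpM2l // ler_sum // => j ij; rewrite ler_wpM2l // expr1.
rewrite big_mkcond [leRHS]big_mkcond /=; apply: ler_sum => k _.
by case: (sub_idx i k); case: (sub_idx j k).
Qed.

(** Let Z be the left-hand side, P the sum of the squares of the weights and B the
    sum of the squares of mass times [weight_above].  Then B <= 2 * K * Z, and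
    Z <= K * P + B / (4 * K) by Young's inequality; all sums being finite, Z can
    be absorbed. *)
Lemma dual_energy_le phi N : (forall j, 0 <= phi j)%R ->
  (\sum_(0 <= j < N) phi j * weight_above phi N j * mass j <=
   2 * K * \sum_(0 <= j < N) phi j ^+ 2)%R.
Proof.
move=> p0; set Z := (X in (X <= _)%R); set P := (X in (_ <= _ * X)%R).
pose B : R := (\sum_(0 <= i < N) mass i ^+ 2 * weight_above phi N i ^+ 2)%R.
(* Exchange the sums over i and j, then use the Carleson condition below j. *)
have BZ : (B <= 2 * K * Z)%R.
  have step i : (mass i ^+ 2 * weight_above phi N i ^+ 2 <=
      \sum_(0 <= j < N | sub_idx i j) 2 * (phi j * weight_above phi N j) * mass i ^+ 2)%R.
    have [mi|mi] := ltP 0%R (mass i); last first.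
      have -> : mass i = 0%R by apply/le_anti; rewrite mi mass_ge0.
      by rewrite expr0n /= mul0r; apply: sumr_ge0 => j _; rewrite mulr0.
    rewrite -mulr_suml mulrC ler_wpM2r ?exprn_ge0 // -mulr_sumr.
    exact: weight_above_sqr_le.
  apply: (le_trans (ler_sum _ (fun i _ => step i))).
  rewrite (exchange_big_dep xpredT) //= mulr_sumr; apply: ler_sum => j _.
  rewrite -mulr_sumr.
  have := sum_below j N; set s := (X in (X <= _)%R -> _) => sK.
  have q0 : (0 <= 2 * (phi j * weight_above phi N j))%R.
    by rewrite !mulr_ge0 // weight_above_ge0.
  have := ler_wpM2l q0 sK; rewrite (_ : (2 * K * _)%R =
    (2 * (phi j * weight_above phi N j) * (K * mass j))%R) //; last by lra.
have ZB : (Z <= K * P + (4 * K)^-1 * B)%R.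
  rewrite !mulr_sumr -big_split /=; apply: ler_sum => j _.
  set a := phi j; set h := weight_above _ _ _; set m := mass j.
  have : (0 <= K * (a - (2 * K)^-1 * (h * m)) ^+ 2)%R.
    by apply: mulr_ge0; [exact: ltW | exact: sqr_ge0].
  (* The weights in Young's inequality are those for which BZ gives Z / 2. *)
  suff -> : (K * (a - (2 * K)^-1 * (h * m)) ^+ 2 =
    K * a ^+ 2 + (4 * K)^-1 * (m ^+ 2 * h ^+ 2) - a * h * m)%R by lra.
  by field; rewrite gt_eqF.
have : ((4 * K)^-1 * B <= 2^-1 * Z)%R.
  rewrite (_ : 2^-1 * Z = (4 * K)^-1 * (2 * K * Z))%R.
    by rewrite ler_wpM2l // invr_ge0 mulr_ge0 // ltW.
  by field; rewrite gt_eqF.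
rewrite -mulrA; lra.
Qed.

Lemma finite_hardy phi N : (forall j, 0 <= phi j)%R ->
  \int[mu]_x ((\sum_(0 <= j < N) phi j * ind j x) ^+ 2)%:E <=
  (4 * K * \sum_(0 <= j < N) phi j ^+ 2)%:E.
Proof.
move=> p0; pose c j : R := (2 * (phi j * weight_above phi N j))%R.
have c0 j : (0 <= c j)%R by rewrite /c !mulr_ge0 // weight_above_ge0.
apply: (@le_trans _ _ (\int[mu]_x
    (\sum_(0 <= j < N) c j * (cst 1 x * ind j x))%:E)).
  apply: ge0_le_integral => //.
  - by move=> x _; rewrite lee_fin sqr_ge0.
  - apply/measurable_EFinP; apply: measurable_funX; apply: measurable_sum => j.
    exact: measurable_funM.
  - apply/measurable_EFinP; apply: measurable_sum => j.
    by apply: measurable_funM => //; apply: measurable_funM.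
  - move=> x _; rewrite lee_fin.
    under [leRHS]eq_bigr do rewrite /= mul1r.
    rewrite !sum_indic.
    have := @chain_expr_le _ _ (fun j k => sub_idx k j) (index_iota 0 N)
      (fun j => `[< S j x >]) phi 1 p0.
    move=> /(_ _ _)/le_trans; apply.
    + by move=> j k l jk kl; exact: sub_idx_trans kl jk.
    + by move=> j k /asboolP Sj /asboolP Sk; rewrite orbC; exact: sub_idx_total Sj Sk.
    rewrite mulr_sumr; apply: ler_sum => j _; rewrite /c ler_wpM2l // ler_wpM2l //.
    rewrite expr1 big_mkcond [leRHS]big_mkcond /=; apply: ler_sum => k _.
    by case: `[< S k x >]; case: (sub_idx j k).
rewrite integral_sum_indic //.
have int1 j : \int[mu]_(x in setT `&` S j) (cst 1%R x)%:E = (mass j)%:E.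
  by rewrite setTI integral_mass mul1r.
under eq_bigr do rewrite int1 -EFinM.
rewrite sumEFin lee_fin.
rewrite (_ : \sum_(0 <= j < N) c j * mass j =
    2 * \sum_(0 <= j < N) phi j * weight_above phi N j * mass j)%R.
  by have := dual_energy_le N p0; lra.
by rewrite mulr_sumr; apply: eq_bigr => j _; rewrite /c !mulrA.
Qed.

Lemma carleson_hardy phi : (forall j, 0 <= phi j)%R ->
  \int[mu]_x (\sum_(j <oo) (phi j * ind j x)%:E) ^+ 2 <=
  (4 * K)%:E * \sum_(j <oo) (phi j ^+ 2)%:E.
Proof.
move=> p0; apply: integral_series_expr_le => //.
- by move=> j; apply: measurable_funM.
- by move=> j x; rewrite mulr_ge0.
move=> N; apply: (le_trans (finite_hardy N p0)).
rewrite EFinM -sumEFin lee_wpmul2l ?lee_fin ?mulr_ge0 ?(ltW K0) //.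
by apply: nneseries_lim_ge => j _; rewrite lee_fin sqr_ge0.
Qed.

Definition mass_below i N x : R :=
  (\sum_(0 <= j < N | sub_idx j i) mass j * ind j x)%R.

Lemma mass_below_ge0 i N x : (0 <= mass_below i N x)%R.
Proof. by apply: sumr_ge0 => j _; rewrite mulr_ge0. Qed.

Lemma measurable_mass_below i N (D : set X) : measurable_fun D (mass_below i N).
Proof.
rewrite /mass_below; under eq_fun do rewrite big_mkcond.
apply: measurable_sum => j; case: (sub_idx j i) => //.
exact: measurable_funM.
Qed.

(** The chain inequality turns one factor of the power into a sum over j, and the
    induction hypothesis applies on S j instead of S i; this is why the bound has
    to be proved for all i at once. *)
Lemma mass_below_moment n i N :
  \int[mu]_(x in S i) (mass_below i N x ^+ n)%:E <=
  (n`!%:R * K ^+ n * mass i)%:E.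
Proof.
elim: n i => [|n IH] i.
  under eq_integral do rewrite expr0.
  by rewrite integral_mass expr0 !mul1r.
have mg j D : measurable_fun D (fun x => mass_below j N x ^+ n)%R.
  by apply: measurable_funX; exact: measurable_mass_below.
pose c j : R := (n.+1%:R * mass j)%R.
have c0 j : (0 <= c j)%R by rewrite mulr_ge0.
apply: (@le_trans _ _ (\int[mu]_(x in S i)
   (\sum_(0 <= j < N | sub_idx j i) c j * (mass_below j N x ^+ n * ind j x))%:E)).
  apply: ge0_le_integral => //.
  - by move=> x _; rewrite lee_fin exprn_ge0 // mass_below_ge0.
  - by apply/measurable_EFinP; apply: measurable_funX; exact: measurable_mass_below.
  - apply/measurable_EFinP; under eq_fun do rewrite big_mkcond.
    apply: measurable_sum => j; case: (sub_idx j i) => //.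
    by apply: measurable_funM => //; apply: measurable_funM.
  - move=> x Six; rewrite lee_fin.
    under [leRHS]eq_bigr do rewrite mulrA.
    rewrite sum_indic [X in (X ^+ _ <= _)%R]sum_indic.
    have := @chain_expr_le _ _ sub_idx (index_iota 0 N)
      (fun j => sub_idx j i && `[< S j x >]) mass n mass_ge0 sub_idx_trans.
    move=> /(_ _)/le_trans; apply.
      move=> j k /andP[_ /asboolP Sj] /andP[_ /asboolP Sk].
      exact: sub_idx_total Sj Sk.
    rewrite mulr_sumr; apply: ler_sum => j /andP[ji _].
    rewrite /c -mulrA ler_wpM2l // ler_wpM2l // lerXn2r //.
    + by rewrite nnegrE; apply: sumr_ge0.
    + by rewrite nnegrE; exact: mass_below_ge0.
    rewrite /mass_below sum_indic big_mkcond [leRHS]big_mkcond /=.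
    apply: ler_sum => k _.
    case: (sub_idx k i); case: `[< S k x >]; case: (sub_idx k j) => //=.
rewrite integral_sum_indic //; last first.
  by move=> j x; rewrite exprn_ge0 // mass_below_ge0.
apply: (@le_trans _ _ (\sum_(0 <= j < N | sub_idx j i)
    (c j * (n`!%:R * K ^+ n * mass j))%:E)).
  apply: lee_sum => j /asboolP ji.
  rewrite (setIidr ji) [leRHS]EFinM lee_wpmul2l ?lee_fin ?c0 //; exact: IH.
rewrite sumEFin lee_fin.
have := sum_below i N; set s := (X in (X <= _)%R -> _) => sK.
rewrite (_ : bigop _ _ _ = n.+1`!%:R * K ^+ n * s)%R; last first.
  rewrite /s mulr_sumr; apply: eq_bigr => j _.
  by rewrite /c factS natrM; ring.
rewrite exprSr -!mulrA ler_wpM2l // ler_wpM2l //.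
by rewrite exprn_ge0 // ltW.
Qed.

(** The sets S j which contain y are either included in S i, and give the second
    term, or contain S i, and then their number is controlled by the Carleson
    condition. *)
Lemma confluent_mass_le_chain i N x : (0 < mass i)%R -> S i x ->
  (\sum_(0 <= j < N) overlap i j * ind j x <= K + mass_below i N x)%R.
Proof.
move=> mi Six; rewrite (bigID (fun j => sub_idx j i)) /= addrC.
apply: lerD; last first.
  by apply: ler_sum => j /overlap_subr ->.
apply: le_trans (sum_above N mi).
rewrite big_mkcond [leRHS]big_mkcond /=; apply: ler_sum => j _.
rewrite indicE; case: (boolP (x \in S j)) => [|_]; last first.
  by rewrite mulr0; case: ifP; case: ifP.
rewrite inE mulr1 => /(sub_idx_total Six)/orP[ij|->/=]; last by case: ifP.
by rewrite ij (overlap_subl ij); case: ifP.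
Qed.

Lemma confluent_mass_moment n i : (0 < n)%N ->
  \int[mu]_(x in S i) confluent_mass i x ^+ n <=
  (2 ^+ n * (K ^+ n + n`!%:R * K ^+ n) * mass i)%:E.
Proof.
move=> n0; apply: integral_series_expr_le => //.
- by move=> j; apply: measurable_funM.
- by move=> j x; rewrite mulr_ge0.
move=> N.
have mF : measurable_fun (S i)
    (fun x => ((\sum_(0 <= j < N) overlap i j * ind j x) ^+ n)%:E).
  apply/measurable_EFinP/measurable_funX; apply: measurable_sum => j.
  exact: measurable_funM.
have [mi|mi] := ltP 0%R (mass i); last first.
  have m0 : mass i = 0%R by apply/le_anti; rewrite mi mass_ge0.
  rewrite null_set_integral ?m0 ?mulr0 //.
  by have := massE i; rewrite m0.
have mg : measurable_fun (S i) (fun x => (mass_below i N x ^+ n)%:E).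
  by apply/measurable_EFinP/measurable_funX; exact: measurable_mass_below.
apply: (@le_trans _ _ (\int[mu]_(x in S i)
    ((2 ^+ n)%:E * ((K ^+ n)%:E + (mass_below i N x ^+ n)%:E)))).
  apply: ge0_le_integral => //.
  - by move=> x _; rewrite lee_fin exprn_ge0 // sumr_ge0 // => j _; rewrite mulr_ge0.
  - by apply: measurable_funeM; apply: emeasurable_funD.
  - move=> x Six; rewrite -EFinD -EFinM lee_fin.
    have := confluent_mass_le_chain N mi Six.
    set G := mass_below i N x; set F := (X in (X <= _)%R -> _) => FG.
    have G0 : (0 <= G)%R by exact: mass_below_ge0.
    have F0 : (0 <= F)%R by apply: sumr_ge0 => j _; rewrite mulr_ge0.
    (* (K + G) ^ n <= (2 * max K G) ^ n <= 2 ^ n * (K ^ n + G ^ n) *)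
    have FM : (F <= 2 * Num.max K G)%R.
      by apply: (le_trans FG); rewrite mulr_natl mulr2n lerD // le_max lexx ?orbT.
    have M0 : (0 <= Num.max K G)%R by rewrite le_max G0 orbT.
    apply: (@le_trans _ _ ((2 * Num.max K G) ^+ n)%R).
      by rewrite lerXn2r ?nnegrE ?mulr_ge0.
    rewrite exprMn ler_wpM2l ?exprn_ge0 //.
    have Kn0 : (0 <= K ^+ n)%R by rewrite exprn_ge0 // ltW.
    have Gn0 : (0 <= G ^+ n)%R by rewrite exprn_ge0.
    by case: (leP K G) => _; rewrite ?lerDl ?lerDr.
rewrite ge0_integralZl //; last 2 first.
  by apply: emeasurable_funD.
  by move=> x _; rewrite -EFinD lee_fin addr_ge0 ?exprn_ge0 ?mass_below_ge0 // ltW.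
rewrite ge0_integralD //; last 2 first.
  by move=> x _; rewrite lee_fin exprn_ge0 // ltW.
  by move=> x _; rewrite lee_fin exprn_ge0 // mass_below_ge0.
rewrite -[leRHS]/(_%:E) -mulrA EFinM lee_wpmul2l ?lee_fin ?exprn_ge0 //.
rewrite mulrDl EFinD leeD //; last exact: mass_below_moment.
by rewrite integral_mass.
Qed.

End Carleson.

Lemma carleson_energy K s : (0 < K)%R -> carleson K -> (0 < s)%R ->
  exists2 e : R, (0 <= e)%R &
    forall i, \int[mu]_(x in S i) (confluent_mass i x `^ s) <= (e * mass i)%:E.
Proof.
move=> K0 carl s0; have [n sn] : exists n, (s <= n%:R)%R.
  by exists (Num.bound s); rewrite ltW // archi_boundP // ltW.
have n0 : (0 < n)%N by rewrite -(ltr0n R) (lt_le_trans s0).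
exists (1 + 2 ^+ n * (K ^+ n + n`!%:R * K ^+ n))%R.
  by rewrite addr_ge0 // mulr_ge0 // ?exprn_ge0 // addr_ge0 // ?mulr_ge0 // exprn_ge0 // ltW.
move=> i; have mg := measurable_confluent_mass i (mS i).
apply: (@le_trans _ _ (\int[mu]_(x in S i) (1 + confluent_mass i x ^+ n))).
  apply: ge0_le_integral => //.
  - by move=> x _; exact: poweR_ge0.
  - exact: (measurableT_comp (measurable_poweR s)).
  - by apply: emeasurable_funD => //; exact: emeasurable_fun_expe.
  - by move=> x _; apply: poweR_le_expe => //; exact: confluent_mass_ge0.
rewrite ge0_integralD //; last 2 first.
  by move=> x _; apply: expe_ge0; exact: confluent_mass_ge0.
  exact: emeasurable_fun_expe.
rewrite mulrDl EFinD leeD //; first by rewrite integral_mass.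
exact: confluent_mass_moment.
Qed.

Lemma energy_carleson s e : (1 <= s)%R ->
  (forall i, \int[mu]_(x in S i) (confluent_mass i x `^ s) <= (e * mass i)%:E) ->
  carleson (1 + e).
Proof.
move=> s1 es i N; have mg := measurable_confluent_mass i (mS i).
have mp : measurable_fun (S i) (fun x => confluent_mass i x `^ s).
  exact: (measurableT_comp (measurable_poweR s)).
rewrite -lee_fin -sumEFin.
apply: (@le_trans _ _ (\int[mu]_(x in S i) confluent_mass i x)).
  rewrite integral_confluent_mass; apply: nneseries_lim_ge => j _.
  by rewrite lee_fin sqr_ge0.
apply: (@le_trans _ _ (\int[mu]_(x in S i) (1 + confluent_mass i x `^ s))).
  apply: ge0_le_integral => //.
  - by move=> x _; exact: confluent_mass_ge0.
  - exact: emeasurable_funD.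
  - by move=> x _; apply: poweR_ge_sub1 => //; exact: confluent_mass_ge0.
rewrite ge0_integralD //; last by move=> x _; exact: poweR_ge0.
by rewrite mulrDl EFinD leeD ?integral_mass.
Qed.

(** Cauchy-Schwarz is replaced by I <= I ^ 2 / (2 * C) + C / 2: integrated over
    S i, it gives Q <= Q / 2 + C * M i / 2 with Q finite. *)
Lemma hardy_carleson C : (0 < C)%R ->
  (forall phi N, (forall j, 0 <= phi j)%R ->
    \int[mu]_x ((\sum_(0 <= j < N) phi j * ind j x) ^+ 2)%:E <=
    (C * \sum_(0 <= j < N) phi j ^+ 2)%:E) ->
  carleson C.
Proof.
move=> C0 hardy i N; set Q := (X in (X <= _)%R).
pose I x : R := (\sum_(0 <= j < N) overlap i j * ind j x)%R.
have mI : measurable_fun setT (fun x => (I x ^+ 2)%:E).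
  apply/measurable_EFinP/measurable_funX; apply: measurable_sum => j.
  exact: measurable_funM.
(* This is the duality between potentials of weights and masses of sets. *)
have QE : Q%:E = \int[mu]_(x in S i) (I x)%:E.
  transitivity (\int[mu]_(x in S i)
      (\sum_(0 <= j < N) overlap i j * (cst 1 x * ind j x))%:E); last first.
    by apply: eq_integral => x _; congr (_%:E); apply: eq_bigr => j _; rewrite mul1r.
  rewrite integral_sum_indic // -sumEFin; apply: eq_bigr => j _.
  rewrite expr2 EFinM; congr (_ * _).
  rewrite (@integral_cst _ _ _ mu (S i `&` S j) _ 1) ?mul1e -?overlapE //.
  exact: measurableI.
have : Q%:E <= ((2 * C)^-1 * (C * Q) + 2^-1 * C * mass i)%:E.
  have C2 : (0 <= (2 * C)^-1)%R by rewrite invr_ge0 mulr_ge0 // ltW.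
  have I2 x : 0 <= (I x ^+ 2)%:E by rewrite lee_fin sqr_ge0.
  rewrite QE; apply: (@le_trans _ _ (\int[mu]_(x in S i)
      ((2 * C)^-1%:E * (I x ^+ 2)%:E + (2^-1 * C)%:E))).
    apply: ge0_le_integral => //.
    - by move=> x _; rewrite lee_fin; apply: sumr_ge0 => j _; rewrite mulr_ge0.
    - apply/measurable_EFinP; apply: measurable_sum => j.
      exact: measurable_funM.
    - apply: emeasurable_funD => //; apply: measurable_funeM.
      exact: measurable_funTS.
    - move=> x _; rewrite -EFinM -EFinD lee_fin.
      have : (0 <= (2 * C)^-1 * (I x - C) ^+ 2)%R by rewrite mulr_ge0 ?sqr_ge0.
      suff -> : ((2 * C)^-1 * (I x - C) ^+ 2 =
        (2 * C)^-1 * I x ^+ 2 + 2^-1 * C - I x)%R by lra.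
      by field; rewrite gt_eqF.
  have mIi : measurable_fun (S i) (fun x => (I x ^+ 2)%:E).
    exact: measurable_funTS.
  rewrite ge0_integralD //; last 3 first.
  - by move=> x _; rewrite mule_ge0.
  - exact: measurable_funeM.
  - by move=> x _; rewrite lee_fin mulr_ge0 // ltW.
  rewrite [leRHS]EFinD leeD //; last by rewrite integral_mass.
  rewrite ge0_integralZl // EFinM lee_wpmul2l ?lee_fin //.
  apply: le_trans (hardy (overlap i) N _) => //.
  exact: ge0_subset_integral.
rewrite lee_fin (_ : (2 * C)^-1 * (C * Q) = 2^-1 * Q)%R; first lra.
by field; rewrite gt_eqF.
Qed.

End Laminar.

(** * Geodesics issued from the pre-root *)

Section Levels.
Variable T : rootedTree.
Implicit Types (u v w : T) (p q : seq T).
Local Notation adj := (@adj T).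
Local Notation o := (preroot T).

Lemma level_ex v :
  exists n, `[< exists2 p, path adj o p & last o p = v /\ size p = n >].
Proof.
have [p [pp lp]] := @tree_connected T o v.
by exists (size p); apply/asboolP; exists p.
Qed.

Definition level v : nat := ex_minn (level_ex v).

Lemma level_path v : exists2 p, path adj o p & last o p = v /\ size p = level v.
Proof. by rewrite /level; case: ex_minnP => n /asboolP. Qed.

Lemma level_le p : path adj o p -> (level (last o p) <= size p)%N.
Proof.
move=> pp; rewrite /level; case: ex_minnP => n _; apply.
by apply/asboolP; exists p.
Qed.

Lemma geodesicE p :
  geodesic adj o p <-> path adj o p /\ size p = level (last o p).
Proof.
split=> [[pp min_p]|[pp sp]]; split=> //.
  have [q pq [lq sq]] := level_path (last o p).
  by apply/eqP; rewrite eqn_leq level_le // -sq min_p.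
by move=> q pq lq; rewrite sp -lq level_le.
Qed.

Lemma geodesic_ex v : exists2 p, geodesic adj o p & last o p = v.
Proof.
have [p pp [lp sp]] := level_path v.
by exists p => //; apply/geodesicE; rewrite sp lp.
Qed.

Lemma level_preroot : level o = 0%N.
Proof. by apply/eqP; rewrite -leqn0; exact: (@level_le [::]). Qed.

Lemma level_eq0 v : level v = 0%N -> v = o.
Proof. by have [p _ [<- <-]] := level_path v => /size0nil ->. Qed.

Lemma level_adj u v : adj u v -> (level v <= (level u).+1)%N.
Proof.
move=> uv; have [p pp [lp sp]] := level_path u.
have := @level_le (rcons p v).
by rewrite last_rcons size_rcons sp rcons_path pp lp; apply.
Qed.

Lemma geodesic_rcons p v : geodesic adj o (rcons p v) ->
  [/\ geodesic adj o p, adj (last o p) v & level v = (level (last o p)).+1].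
Proof.
move=> /geodesicE; rewrite rcons_path last_rcons size_rcons.
move=> [/andP[pp lpv] sp].
have := level_adj lpv; rewrite -sp ltnS => le1.
have sp' : size p = level (last o p).
  by apply/eqP; rewrite eqn_leq le1 level_le.
by split=> //; [apply/geodesicE | rewrite sp'].
Qed.

Lemma lower_nbr_ex v : v != o -> exists2 u, adj u v & level v = (level u).+1.
Proof.
have [p gp <-] := geodesic_ex v; case/lastP: p gp => [|p w] gp.
  by rewrite eqxx.
rewrite last_rcons => _; have [_ ? ?] := geodesic_rcons gp.
by exists (last o p).
Qed.

(** Two distinct vertices of level k cannot be joined by a simple path which
    stays at levels at least k: prolonging both ends one level down gives either
    a cycle or such a path at level k - 1, and level 0 has a single vertex. *)
Lemma no_upper_path k u p :
  path adj u p -> uniq (u :: p) -> (0 < size p)%N ->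
  level u = k -> level (last u p) = k ->
  (forall w, w \in u :: p -> (k <= level w)%N) -> False.
Proof.
elim: k u p => [|k IH] u p pp up p0 lu lp above.
  have := level_eq0 lp; rewrite -(level_eq0 lu) => e.
  case/lastP: p pp up p0 lp above e => // p w _ + _ _ _.
  by rewrite last_rcons => + e; rewrite e /= mem_rcons in_cons eqxx.
have nz w : level w = k.+1 -> w != o.
  by move=> lw; apply/eqP => e; rewrite e level_preroot in lw.
have [a au la] := lower_nbr_ex (nz _ lu).
have [b bp lb] := lower_nbr_ex (nz _ lp).
move: la lb; rewrite lu lp => -[la] [lb].
have notin c : level c = k -> c \notin u :: p.
  by move=> lc; apply/negP => /above; rewrite -lc ltnn.
have path_b : path adj u (rcons p b) by rewrite rcons_path pp /= adj_sym.
have [ab|ab] := eqVneq a b.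
  have := @tree_acyclic T (a :: u :: p).
  rewrite /= -ab in path_b notin *; rewrite au path_b notin //=.
  by move: up => /= /andP[-> ->] /=; rewrite !ltnS p0; move=> /(_ isT isT).
(* The path grows at both ends, and its ends are now at level k. *)
apply: (IH a (u :: rcons p b)) => //.
- by rewrite /= au.
- rewrite -[uniq _]/(uniq (a :: rcons (u :: p) b)) cons_uniq mem_rcons in_cons.
  by rewrite negb_or ab rcons_uniq up !notin.
- by rewrite /= last_rcons.
- move=> w; rewrite in_cons -rcons_cons mem_rcons in_cons.
  move=> /or3P[/eqP->|/eqP->|/above /ltnW//]; by rewrite -?la -?lb.
Qed.

Lemma lower_nbr_unique u w v : adj u v -> adj w v ->
  level v = (level u).+1 -> level v = (level w).+1 -> u = w.
Proof.
move=> uv wv lu lw; apply/eqP/negP => /negP uw.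
have lwu : level w = level u by move: lw; rewrite lu => -[].
apply: (@no_upper_path (level u) u [:: v; w]) => //=.
- by rewrite uv adj_sym wv.
- rewrite !inE !negb_or uw !andbT; apply/andP; split.
    by apply/eqP => e; rewrite -e in lu; move: (n_Sn _ lu).
  by apply/eqP => e; rewrite -e in lw; move: (n_Sn _ lw).
- by move=> z; rewrite !inE => /or3P[] /eqP->; rewrite ?lu ?lwu.
Qed.

(** The default value makes the pre-root its own parent, so that the iterates of
    [parent] go down to the pre-root and stay there. *)
Definition parent v : T :=
  xget o [set u | adj u v /\ level v = (level u).+1].

Lemma parentP v : v != o ->
  adj (parent v) v /\ level v = (level (parent v)).+1.
Proof.
move=> vo; apply: (@xgetPex _ o [set u | adj u v /\ level v = (level u).+1]).
by have [u ? ?] := lower_nbr_ex vo; exists u.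
Qed.

Lemma parent_unique u v : adj u v -> level v = (level u).+1 -> u = parent v.
Proof.
move=> uv lu; have vo : v != o.
  by apply/eqP => e; rewrite e level_preroot in lu.
have [pv lp] := parentP vo; exact: lower_nbr_unique uv pv lu lp.
Qed.

Lemma parent_preroot : parent o = o.
Proof.
rewrite /parent; case: xgetP => // u _ [_].
by rewrite level_preroot.
Qed.

Lemma level_parent v : level (parent v) = (level v).-1.
Proof.
have [->|/parentP[_ ->] //] := eqVneq v o.
by rewrite parent_preroot level_preroot.
Qed.

Lemma level_iter_parent k v : level (iter k parent v) = (level v - k)%N.
Proof. by elim: k => [|k IH]; rewrite ?subn0 //= level_parent IH subnS. Qed.

Lemma level_gt0 v : (0 < level v)%N = (v != o).
Proof.
rewrite lt0n; congr (~~ _); apply/eqP/eqP => [/level_eq0//|->].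
exact: level_preroot.
Qed.

Lemma level1 v : level v = 1%N -> v = root T.
Proof.
move=> lv; have vo : v != o by rewrite -level_gt0 lv.
have [] := parentP vo; rewrite lv => + [/esym/level_eq0 e].
by rewrite e preroot_adj => /eqP.
Qed.

Lemma geodesic_ray_level g : g 0%N = o -> geodesic_ray adj g ->
  forall n, level (g n) = n /\ adj (g n) (g n.+1).
Proof.
move=> g0 geo n.
have lastE m : last o (mkseq (fun i => g i.+1) m) = g m.
  by case: m => // m; rewrite mkseqS last_rcons.
have := geo n; rewrite g0 => /geodesicE[_].
rewrite size_mkseq lastE => <-; split=> //.
by have := geo n.+1; rewrite g0 mkseqS => /geodesic_rcons[_]; rewrite lastE.
Qed.

(** * Trunks, confluents and shadows *)

(** In a tree an edge is known by its end point farther from the pre-root, so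
    sets of edges of geodesics can be studied as sets of vertices. *)
Definition parent_edge v : {fset T} := [fset parent v; v]%fset.

Lemma parent_edge_inj u v : u != o -> v != o ->
  parent_edge u = parent_edge v -> u = v.
Proof.
move=> uo vo e.
have := fset22 (parent u) u; rewrite -/(parent_edge u) e => /fset2P[up|//].
have := fset22 (parent v) v; rewrite -/(parent_edge v) -e => /fset2P[vp|//].
have [_] := parentP uo; have [_] := parentP vo; rewrite -up -vp; lia.
Qed.

(** The common shape of the vertex sets of all maximal or finite geodesics
    issued from the pre-root, the latter being left out. *)
Record trunk (A : set T) : Prop := Trunk {
  trunk_root : A (root T);
  trunk_nonroot : forall u, A u -> u != o;
  trunk_parent : forall u, A u -> parent u != o -> A (parent u);
  trunk_level_inj : forall u v, A u -> A v -> level u = level v -> u = v }.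

Lemma trunk_iter A u k : trunk A -> A u -> (k < level u)%N ->
  A (iter k parent u).
Proof.
move=> tA Au; elim: k => // k IH kl /=.
apply: (trunk_parent tA); first exact/IH/ltnW.
by rewrite -level_gt0 -iterS level_iter_parent subn_gt0.
Qed.

Lemma trunk_below A u v : trunk A -> A u -> A v -> (level u <= level v)%N ->
  u = iter (level v - level u) parent v.
Proof.
move=> tA Au Av uv; apply: (trunk_level_inj tA Au).
  apply: trunk_iter => //; rewrite ltn_subrL.
  by rewrite !level_gt0 !(trunk_nonroot tA).
by rewrite level_iter_parent subKn.
Qed.

(** A trunk is determined up to the level of any of its elements. *)
Lemma trunk_sub A B u v : trunk A -> trunk B -> A v -> B v ->
  A u -> (level u <= level v)%N -> B u.
Proof.
move=> tA tB Av Bv Au uv; rewrite (trunk_below tA Au Av uv).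
apply: trunk_iter => //; rewrite ltn_subrL.
by rewrite !level_gt0 (trunk_nonroot tA) // (trunk_nonroot tA).
Qed.

Lemma trunkI A B : trunk A -> trunk B -> trunk (A `&` B).
Proof.
move=> tA tB; split=> [|u [Au _]|u [Au Bu] pu|u v [Au _] [Av _]].
- by split; exact: trunk_root.
- exact: trunk_nonroot tA _ Au.
- by split; [exact: (trunk_parent tA) | exact: (trunk_parent tB)].
- exact: trunk_level_inj tA _ _ Au Av.
Qed.

Definition ancestors v : set T :=
  [set u | u != o /\ exists k, u = iter k parent v].

Lemma ancestors_self v : v != o -> ancestors v v.
Proof. by move=> vo; split=> //; exists 0%N. Qed.

Lemma level_ancestors u v : ancestors v u -> (level u <= level v)%N.
Proof. by move=> [_ [k ->]]; rewrite level_iter_parent leq_subr. Qed.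

Lemma trunk_ancestors v : v != o -> trunk (ancestors v).
Proof.
move=> vo; have lv : (0 < level v)%N by rewrite level_gt0.
have rootE : root T = iter (level v).-1 parent v.
  apply/esym/level1; rewrite level_iter_parent.
  by case: (level v) lv => // n _; rewrite subSn ?subnn.
split.
- by split; [exact: root_neq_preroot | exists (level v).-1].
- by move=> u [].
- by move=> u [_ [k e]] po; split=> //; exists k.+1; rewrite e.
- move=> u w [uo [j eu]] [wo [k ew]]; move: uo; rewrite -level_gt0 eu ew.
  rewrite !level_iter_parent => pos e; congr (iter _ parent v); lia.
Qed.

Lemma ancestors_parent v : v != o ->
  ancestors v = v |` ancestors (parent v).
Proof.
move=> vo; apply/seteqP; split=> u.
  move=> [uo [[|k] e]]; [by left|right].
  by split=> //; exists k; rewrite e iterSr.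
move=> [->|[uo [k e]]]; first exact: ancestors_self.
by split=> //; exists k.+1; rewrite iterSr.
Qed.

Lemma path_edges_geodesic p : geodesic adj o p ->
  [set a | a \in path_edges o p] = parent_edge @` ancestors (last o p).
Proof.
elim/last_ind: p => [|p v IH] gp.
  apply/seteqP; split=> // a [u [uo [k ek]] _].
  by move: uo; rewrite -level_gt0 ek level_iter_parent /= level_preroot.
have [gp' pv lv] := geodesic_rcons gp.
have vo : v != o by rewrite -level_gt0 lv.
have e : path_edges o (rcons p v) =
    rcons (path_edges o p) (parent_edge v).
  by rewrite /path_edges -cats1 pairmap_cat cats1 /parent_edge -(parent_unique pv lv).
rewrite last_rcons ancestors_parent // image_setU image_set1.
rewrite -(parent_unique pv lv) -IH // e.
apply/seteqP; split=> a /=; rewrite mem_rcons in_cons.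
  by move=> /orP[/eqP->|]; [left|right].
by move=> [->|->]; rewrite ?eqxx ?orbT.
Qed.

Definition visited (x : Tbar T) : set T :=
  match x with
  | Inner v _ => ancestors v
  | Bdry g _ _ => [set g n.+1 | n in [set: nat]]
  end.

Lemma stem_visited x : stem x = parent_edge @` visited x.
Proof.
case: x => [v vo|g g0 geo] /=.
  apply/seteqP; split=> a.
    move=> [p [gp <-]]; have /seteqP[+ _] := path_edges_geodesic gp; exact.
  have [p gp lp] := geodesic_ex v.
  rewrite -{1}lp -path_edges_geodesic // => ap; by exists p.
have gE n : parent_edge (g n.+1) = [fset g n; g n.+1]%fset.
  have [ln an] := geodesic_ray_level g0 geo n.
  have [lSn _] := geodesic_ray_level g0 geo n.+1.
  by rewrite /parent_edge -(parent_unique an) // ln lSn.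
apply/seteqP; split=> [_ [n _ <-]|_ [_ [n _ <-] <-]].
  by exists (g n.+1) => //; exists n.
by exists n.
Qed.

Lemma trunk_visited x : trunk (visited x).
Proof.
case: x => [v vo|g g0 geo]; first exact: trunk_ancestors.
have lg n : level (g n) = n by have [] := geodesic_ray_level g0 geo n.
have ag n : adj (g n) (g n.+1) by have [] := geodesic_ray_level g0 geo n.
split.
- by exists 0%N => //; apply: level1; rewrite lg.
- by move=> _ [n _ <-]; rewrite -level_gt0 lg.
- move=> _ [[|n] _ <-]; rewrite -(parent_unique (ag _)) ?lg ?g0 ?eqxx // => _.
  by exists n.
- by move=> _ _ [m _ <-] [n _ <-]; rewrite !lg => ->.
Qed.

(** If the levels of the elements are bounded the trunk consists of the
    ancestors of its top element; otherwise it is the image of a ray. *)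
Lemma trunk_realized A : trunk A -> exists x, visited x = A.
Proof.
move=> tA.
have [[v [Av topv]]|unb] :=
    pselect (exists v, A v /\ forall u, A u -> (level u <= level v)%N).
  have vo := trunk_nonroot tA Av; have tv := trunk_ancestors vo.
  exists (Inner vo); apply/seteqP; split=> u /= Hu.
    apply: (trunk_sub tv tA (ancestors_self vo)) => //; exact: level_ancestors.
  by apply: (trunk_sub tA tv Av (ancestors_self vo)) => //; exact: topv.
have climb n : exists2 u, A u & (n < level u)%N.
  elim: n => [|n [u Au nu]].
    exists (root T); first exact: trunk_root.
    by rewrite level_gt0 root_neq_preroot.
  apply: contrapT => H; apply: unb; exists u; split=> // w Aw.
  rewrite leqNgt; apply/negP => uw; apply: H; exists w => //.
  exact: leq_ltn_trans uw.
have pick n : exists u, A u /\ level u = n.+1.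
  have [u Au nu] := climb n; exists (iter (level u - n.+1) parent u).
  rewrite level_iter_parent subKn //; split=> //.
  by apply: trunk_iter => //; lia.
pose h n := xget o [set u | A u /\ level u = n.+1].
have hP n : A (h n) /\ level (h n) = n.+1.
  exact: (xgetPex o (pick n)).
pose g n := if n is m.+1 then h m else o.
have lg n : level (g n) = n.
  by case: n => [|n]; [exact: level_preroot | have [] := hP n].
have pg n : g n = parent (g n.+1).
  have [Ah lh] := hP n.
  case: n Ah lh => [|n] Ah lh /=.
    by apply/esym/level_eq0; rewrite level_parent lh.
  have [Ah' lh'] := hP n; apply: (trunk_level_inj tA) => //; last first.
    by rewrite level_parent lh lh'.
  by apply: (trunk_parent tA) => //; rewrite -level_gt0 level_parent lh.
have ag n : adj (g n) (g n.+1).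
  by rewrite pg; apply parentP; rewrite -level_gt0 lg.
have geo : geodesic_ray adj g.
  move=> n; apply/geodesicE; rewrite size_mkseq.
  elim: n => [|n [pn ln]]; first by rewrite level_preroot.
  have lastE m : last o (mkseq (fun i => g i.+1) m) = g m.
    by case: m => // m; rewrite mkseqS last_rcons.
  by rewrite lastE lg mkseqS rcons_path pn lastE ag.
exists (Bdry (erefl : g 0%N = o) geo); apply/seteqP; split=> [_ [n _ <-]|u Au].
  by have [] := hP n.
have lu : (0 < level u)%N by rewrite level_gt0 (trunk_nonroot tA).
have [Ah lh] := hP (level u).-1.
exists (level u).-1 => //; apply: (trunk_level_inj tA) => //.
by rewrite lg prednK.
Qed.

Lemma image_parent_edgeI A B : trunk A -> trunk B ->
  parent_edge @` A `&` parent_edge @` B = parent_edge @` (A `&` B).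
Proof.
move=> tA tB; apply/seteqP; split=> [_ [[u Au <-] [v Bv e]]|_ [u [Au Bu] <-]].
  have uv : v = u by apply: parent_edge_inj e; [exact: trunk_nonroot tB _ Bv
                                               |exact: trunk_nonroot tA _ Au].
  by exists u => //; split=> //; rewrite -uv.
by split; exists u.
Qed.

(** The intersection of two trunks is a trunk, hence is visited by some point;
    this provides the witness needed by the definition of the confluent. *)
Lemma stem_confluent (x y : Tbar T) : stem (confluent x y) = stem x `&` stem y.
Proof.
apply: (@getPex _ [set z : Tbar T | stem z = stem x `&` stem y]).
have [z ez] := trunk_realized (trunkI (trunk_visited x) (trunk_visited y)).
exists z => /=; rewrite !stem_visited ez image_parent_edgeI //; exact: trunk_visited.
Qed.

(** Two edges of a common geodesic are comparable, and every geodesic through the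
    farther one passes through the nearer one. *)
Lemma shadow_laminar (a b : {fset T}) :
  [\/ shadow a `&` shadow b = set0,
      shadow a `<=` shadow b | shadow b `<=` shadow a].
Proof.
have [->|/set0P[z []]] := eqVneq (shadow a `&` shadow b) set0.
  by constructor 1.
rewrite /shadow /= !stem_visited => -[u zu <-] [v zv <-].
have below (p q : T) : visited z p -> visited z q -> (level p <= level q)%N ->
    shadow (parent_edge q) `<=` shadow (parent_edge p).
  move=> zp zq pq x; rewrite /shadow /= !stem_visited => -[w xw e].
  have tx := trunk_visited x; have tz := trunk_visited z.
  have wq : w = q.
    by apply: parent_edge_inj e; [exact: trunk_nonroot tx _ xw
                                 |exact: trunk_nonroot tz _ zq].
  by exists p => //; apply: (trunk_sub tz tx zq) => //; rewrite -wq.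
by have [/below|/ltnW/below] := leqP (level u) (level v); [constructor 3|constructor 2]; auto.
Qed.

Lemma stem_edges x : stem x `<=` @edges T.
Proof.
move=> a; rewrite stem_visited => -[u /(trunk_nonroot (trunk_visited x)) uo <-].
by have [pu _] := parentP uo; exists (parent u), u.
Qed.

Lemma measurable_shadow (a : {fset T}) : edges a ->
  measurable (shadow a : set (borelTbar T)).
Proof.
move=> ea; apply: sub_sigma_algebra.
exists [set shadow a]; last by rewrite bigcup_set1.
move=> _ ->; exists [fset shadow a]%fset.
  by move=> b /fset1P ->; rewrite inE; left; exists a.
by rewrite set_fset1 bigcap_set1.
Qed.

End Levels.

(** * From shadows to a laminar sequence *)

Local Notation code := (@choice.pickle _).

Lemma counting_esum (R : realType) (I : choiceType) (A : set I) :
  counting A = \esum_(i in A) 1 :> \bar R.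
Proof.
rewrite /counting; case: asboolP => [fA|infA].
  rewrite esum_fset // fsbig_finite //= big_const_seq count_predT.
  by elim: (size _) => [|n IH] //=; rewrite -IH -EFinD -mulrS.
apply/esym/eqyP => r r0; have [F FA Fr] := infinite_set_fset (Num.bound r) infA.
apply: esum_ge; exists [set` F]; first by split; [exact: finite_fset | exact: FA].
rewrite fsbig_finite ?set_fsetK //=.
rewrite big_const_seq count_predT -[iter _ _ _]/(iter (size F) (adde 1) 0).
have -> : iter (size F) (adde 1) 0 = (size F)%:R%:E :> \bar R.
  by elim: (size _) => [|n IH] //=; rewrite IH mulrS EFinD.
rewrite lee_fin (le_trans (ltW (archi_boundP (ltW r0)))) // ler_nat.
exact: Fr.
Qed.

Lemma esum_pickle (R : realType) (I : countType) (A : set I)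
    (f : nat -> \bar R) :
  (forall n, 0 <= f n) ->
  \esum_(i in A) f (code i) =
  \sum_(n <oo) (if n \in code @` A then f n else 0).
Proof.
move=> f0; rewrite nneseries_esumT; last by move=> n; case: ifP.
rewrite -esum_mkcond; apply/esym/reindex_esum.
by apply: inj_bij => i j _ _; exact: (pcan_inj choice.pickleK).
Qed.

Section TreeHardy.
Variables (R : realType) (T : rootedTree).
Variable mu : {finite_measure set (borelTbar T) -> \bar R}.

(** Since stems consist of edges, this is the shadow of the edge coded by n, and
    the empty set if n codes no edge. *)
Definition shadow_seq (n : nat) : set (borelTbar T) :=
  [set x | (code @` stem x) n].

Lemma shadow_seq_pickle (a : {fset T}) : shadow_seq (code a) = shadow a.
Proof.
apply/seteqP; split=> x /= => [[b xb /(pcan_inj choice.pickleK) <-//]|xa].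
by exists a.
Qed.

Lemma shadow_seqP n : shadow_seq n = set0 \/
  exists a : {fset T}, [/\ edges a, n = code a & shadow_seq n = shadow a].
Proof.
have [->|/set0P[x [a xa <-]]] := eqVneq (shadow_seq n) set0; [by left|right].
by exists a; split; [exact: stem_edges xa | by [] | exact: shadow_seq_pickle].
Qed.

Lemma measurable_shadow_seq n : measurable (shadow_seq n).
Proof.
have [->|[a [ea _ ->]]] := shadow_seqP n; first exact: measurable0.
exact: measurable_shadow.
Qed.

Lemma shadow_seq_laminar m n :
  [\/ shadow_seq m `&` shadow_seq n = set0,
      shadow_seq m `<=` shadow_seq n | shadow_seq n `<=` shadow_seq m].
Proof.
have [->|[a [_ _ ->]]] := shadow_seqP m; first by constructor 2.
have [->|[b [_ _ ->]]] := shadow_seqP n; first by constructor 3.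
exact: shadow_laminar.
Qed.

Lemma esum_stem (f : nat -> R) (x : borelTbar T) : (forall n, 0 <= f n)%R ->
  \esum_(a in stem x) (f (code a))%:E =
  \sum_(n <oo) (f n * \1_(shadow_seq n) x)%:E.
Proof.
move=> f0; rewrite (@esum_pickle _ _ _ (fun n => (f n)%:E)); last first.
  by move=> n; rewrite lee_fin.
apply: eq_eseriesr => n _; rewrite indicE.
rewrite (_ : (x \in shadow_seq n) = (n \in code @` stem x)).
  by case: ifP => _; rewrite ?mulr1 ?mulr0.
by apply/idP/idP; rewrite !inE.
Qed.

Lemma integral_depth (a : {fset T}) (y : borelTbar T) : edges a ->
  \int[mu]_(x in shadow a) depth R (confluent x y) =
  confluent_mass mu shadow_seq (code a) y.
Proof.
move=> ea; have ma := measurable_shadow ea.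
have E x : depth R (confluent x y) = \sum_(n <oo)
    (\1_(shadow_seq n) y * \1_(shadow_seq n) x)%:E.
  rewrite /depth stem_confluent counting_esum setIC esum_mkcondr.
  transitivity (\esum_(b in stem y) (\1_(shadow_seq (code b)) x : R)%:E).
    apply: eq_esum => b yb; rewrite indicE shadow_seq_pickle.
    rewrite (_ : (x \in shadow b) = (b \in stem x)); first by case: ifP.
    by apply/idP/idP; rewrite !inE.
  rewrite (esum_stem y (f := fun n => \1_(shadow_seq n) x)) //.
  by apply: eq_eseriesr => n _; rewrite mulrC.
under eq_integral do rewrite E.
rewrite integral_nneseries //.
- apply: eq_eseriesr => n _; under eq_integral do rewrite EFinM.
  rewrite ge0_integralZl ?lee_fin //; last first.
    by apply/measurable_EFinP; exact: measurable_indic (measurable_shadow_seq n).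
  rewrite integral_indic //; last exact: measurable_shadow_seq.
  rewrite mulrC EFinM; congr (_ * _); rewrite setIC -shadow_seq_pickle.
  exact: (overlapE mu measurable_shadow_seq).
- move=> n; apply/measurable_EFinP; apply: measurable_funM => //.
  by apply: measurable_indic; exact: measurable_shadow_seq.
Qed.

Lemma integral_depth_poweR (a : {fset T}) s : edges a ->
  \int[mu]_(y in shadow a)
    ((\int[mu]_(x in shadow a) depth R (confluent x y)) `^ s) =
  \int[mu]_(y in shadow_seq (code a)) (confluent_mass mu shadow_seq (code a) y `^ s).
Proof.
move=> ea; rewrite shadow_seq_pickle.
by apply: eq_integral => y _; rewrite integral_depth.
Qed.

(** Multiplying by mu (S(a)) removes the quotient; on null shadows both sides of
    the new inequality vanish, in agreement with the convention on quotients. *)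
Lemma energy_lty s : energy mu s < +oo <->
  exists2 e : R, (0 <= e)%R & forall i,
    \int[mu]_(x in shadow_seq i) (confluent_mass mu shadow_seq i x `^ s) <=
    (e * mass mu shadow_seq i)%:E.
Proof.
have mS := measurable_shadow_seq.
have muE a : mu (shadow a) = (mass mu shadow_seq (code a))%:E.
  by rewrite -shadow_seq_pickle; exact: massE mS _.
split=> [fin_e|[e e0 He]]; last first.
  apply: (@le_lt_trans _ _ e%:E); last exact: ltry.
  apply: ge_ereal_sup => _ [a ea <-]; rewrite muE.
  have := He (code a); rewrite integral_depth_poweR //.
  set m := mass _ _ _; have m0 : (0 <= m)%R by exact: mass_ge0.
  rewrite eqe; case: eqVneq => [_ _|mn0 le_em]; first by rewrite lee_fin.
  have mp : (0 < m)%R by rewrite lt_def mn0.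
  by rewrite inver (negbTE mn0) lee_pdivrMl // -EFinM mulrC.
have [e e0 le_e] : exists2 e : R, (0 <= e)%R & energy mu s <= e%:E.
  case: (energy mu s) fin_e => [r _||]; last 2 first.
  - by rewrite ltxx.
  - by exists 0%R => //; rewrite leNye.
  - by exists (Num.max 0 r)%R; rewrite ?lee_fin le_max lexx ?orbT.
exists e => // i.
have [->|[a [ea -> _]]] := shadow_seqP i.
  by rewrite integral_set0 lee_fin mulr_ge0 // mass_ge0.
have mg : measurable_fun (shadow_seq (code a))
    (fun x => confluent_mass mu shadow_seq (code a) x `^ s).
  apply: (measurableT_comp (measurable_poweR s)).
  exact: measurable_confluent_mass.
rewrite -integral_depth_poweR //.
have := le_trans (ereal_sup_ubound (imageP _ ea)) le_e.
rewrite /= integral_depth_poweR // muE.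
set m := mass _ _ _; have m0 : (0 <= m)%R by exact: mass_ge0.
rewrite eqe; case: eqVneq => [me _|mn0].
  rewrite null_set_integral ?me ?mulr0 //.
  by have := massE mu mS (code a); rewrite -/m me.
have mp : (0 < m)%R by rewrite lt_def mn0.
by rewrite inver (negbTE mn0) lee_pdivrMl // -EFinM mulrC.
Qed.

Lemma nneseries_support (f : nat -> R) N : (forall n, 0 <= f n)%R ->
  (forall n, (N <= n)%N -> f n = 0%R) ->
  \sum_(n <oo) (f n)%:E = (\sum_(0 <= n < N) f n)%:E.
Proof.
move=> f0 fN; rewrite (nneseries_split 0 N) //; last first.
  by move=> n _; rewrite lee_fin.
rewrite add0n sumEFin [X in _ + X]eseries0 ?adde0 // => n Nn _.
by rewrite fN.
Qed.

(** A weight on the codes with finite support is a weight on the edges; the codes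
    of no edge only add to the right-hand side. *)
Lemma hardy_shadow_seq C : (0 <= C)%R ->
  (forall phi : {fset T} -> R, (forall a, edges a -> (0 <= phi a)%R) ->
    \int[mu]_x ((\esum_(a in stem x) (phi a)%:E) ^+ 2) <=
    C%:E * \esum_(a in @edges T) (phi a ^+ 2)%:E) ->
  forall phi N, (forall j, 0 <= phi j)%R ->
    \int[mu]_x ((\sum_(0 <= j < N) phi j * \1_(shadow_seq j) x) ^+ 2)%:E <=
    (C * \sum_(0 <= j < N) phi j ^+ 2)%:E.
Proof.
move=> C0 hardy phi N p0.
pose psi j : R := if (j < N)%N then phi j else 0%R.
have psi0 j : (0 <= psi j)%R by rewrite /psi; case: ifP.
have psiN j : (N <= j)%N -> psi j = 0%R by rewrite /psi ltnNge => ->.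
have eq_psi (F : nat -> R -> R) :
    (\sum_(0 <= j < N) F j (psi j) = \sum_(0 <= j < N) F j (phi j))%R.
  by apply: eq_big_nat => j /andP[_ jN]; rewrite /psi jN.
apply: (@le_trans _ _ (\int[mu]_x (\esum_(a in stem x) (psi (code a))%:E) ^+ 2)).
  rewrite (_ : \int[mu]_x _ = \int[mu]_x (\esum_(a in stem x) (psi (code a))%:E) ^+ 2) //.
  apply: eq_integral => x _; rewrite esum_stem //.
  rewrite (@nneseries_support (fun n => psi n * \1_(shadow_seq n) x)%R N).
  - by rewrite -EFin_expe (eq_psi (fun j t => t * \1_(shadow_seq j) x)%R).
  - by move=> j; rewrite mulr_ge0.
  - by move=> j /psiN ->; rewrite mul0r.
apply: (le_trans (hardy (fun a => psi (code a)) (fun a _ => psi0 _))).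
rewrite EFinM lee_wpmul2l ?lee_fin //.
rewrite (@esum_pickle _ _ _ (fun n => (psi n ^+ 2)%:E)); last first.
  by move=> n; rewrite lee_fin sqr_ge0.
apply: (@le_trans _ _ (\sum_(n <oo) (psi n ^+ 2)%:E)).
  by apply: lee_nneseries => n *; case: ifP; rewrite ?lexx ?lee_fin ?sqr_ge0.
rewrite (@nneseries_support (fun n => psi n ^+ 2)%R N).
- by rewrite (eq_psi (fun _ t => t ^+ 2)%R).
- by move=> j; rewrite sqr_ge0.
- by move=> j /psiN ->; rewrite expr0n.
Qed.

Definition edge_weight (phi : {fset T} -> R) (n : nat) : R :=
  if choice.pickle_inv n is Some a then
    if `[< edges a >] then phi a else 0%R
  else 0%R.

Lemma edge_weightE phi (a : {fset T}) :
  edges a -> edge_weight phi (code a) = phi a.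
Proof. by move=> ea; rewrite /edge_weight choice.pickleK_inv asboolT. Qed.

Lemma edge_weight_ge0 phi n :
  (forall a : {fset T}, edges a -> (0 <= phi a)%R) ->
  (0 <= edge_weight phi n)%R.
Proof.
by rewrite /edge_weight => p0; case: choice.pickle_inv => // a; case: asboolP => // /p0.
Qed.

Lemma series_edge_weight phi :
  \sum_(n <oo) (edge_weight phi n ^+ 2)%:E =
  \esum_(a in @edges T) (phi a ^+ 2)%:E.
Proof.
transitivity (\esum_(a in @edges T) (edge_weight phi (code a) ^+ 2)%:E); last first.
  by apply: eq_esum => a ea; rewrite edge_weightE.
rewrite (@esum_pickle _ _ _ (fun n => (edge_weight phi n ^+ 2)%:E)); last first.
  by move=> n; rewrite lee_fin sqr_ge0.
apply: eq_eseriesr => n _; case: ifP => // /negbT/negP nE.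
rewrite /edge_weight; have := @choice.pickle_invK {fset T} n.
case: choice.pickle_inv => [a /= an|_]; last by rewrite expr0n.
case: asboolP => ea; last by rewrite expr0n.
by case: nE; rewrite inE -an; exists a.
Qed.

End TreeHardy.

Theorem theorem3 (R : realType) (T : rootedTree)
    (mu : {finite_measure set (borelTbar T) -> \bar R}) :
  ((exists C : R, forall phi : {fset T} -> R,
      (forall a, edges a -> (0 <= phi a)%R) ->
      \int[mu]_x ((\esum_(a in stem x) (phi a)%:E) ^+ 2)
        <= C%:E * \esum_(a in @edges T) ((phi a) ^+ 2)%:E)
   <-> (exists s : R, (1 <= s)%R /\ energy mu s < +oo))
  /\
  ((exists s : R, (1 <= s)%R /\ energy mu s < +oo)
   <-> (forall s : R, (1 <= s)%R -> energy mu s < +oo)).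
Proof.
have mS := @measurable_shadow_seq T; have lam := @shadow_seq_laminar T.
have carlb s : (1 <= s)%R -> energy mu s < +oo ->
    exists2 K : R, (0 < K)%R & carleson mu (@shadow_seq T) K.
  move=> s1 /energy_lty[e e0 He]; exists (1 + e)%R; first by rewrite ltr_wpDr.
  exact: energy_carleson s1 He.
have carlc K s : (0 < K)%R -> carleson mu (@shadow_seq T) K -> (1 <= s)%R ->
    energy mu s < +oo.
  move=> K0 carl s1; apply/energy_lty.
  exact: (carleson_energy mS lam K0 carl (lt_le_trans ltr01 s1)).
split; split.
- move=> [C hardy]; exists 1%R; split=> //.
  have C1 : (0 < Num.max C 1)%R by rewrite lt_max ltr01 orbT.
  apply: (carlc _ _ C1) => //; apply: hardy_carleson => //.
  apply: hardy_shadow_seq => [|phi p0]; first exact: ltW.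
  apply: le_trans (hardy phi p0) _; rewrite lee_wpmul2r //.
    by apply: esum_ge0 => a _; rewrite lee_fin sqr_ge0.
  by rewrite lee_fin le_max lexx.
- move=> [s [s1 /(carlb _ s1)[K K0 carl]]]; exists (4 * K)%R => phi p0.
  have w0 n := edge_weight_ge0 n p0.
  have := carleson_hardy mS lam K0 carl w0; rewrite series_edge_weight.
  apply: le_trans; rewrite le_eqVlt; apply/orP; left; apply/eqP.
  apply: eq_integral => x _; rewrite -esum_stem //; congr (_ ^+ 2).
  by apply: eq_esum => a xa; rewrite edge_weightE //; exact: stem_edges xa.
- by move=> [s [s1 /(carlb _ s1)[K K0 carl]]] t t1; exact: carlc carl t1.
- by move=> all_s; exists 1%R; split=> //; exact: all_s.
Qed.
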